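(* Let $X$ be a compact Hausdorff space, and let $C(X)$ be the $C^*$-algebra of continuous complex-valued functions on $X$. There is a bijective correspondence $$\{Y\subseteq X \mid Y \text{ is closed}\}\longleftrightarrow\{\text{closed ideals of } C(X)\}.$$
   Context: $C(X)$ carries pointwise operations, the norm $\|f\|_\infty=\sup_{x\in X}|f(x)|$ and the involution $f^*(x)=\overline{f(x)}$. An ideal of $C(X)$ is a self-adjoint (closed under $*$) linear subspace $I$ with $fg\in I$ for all $f\in C(X)$, $g\in I$; it is closed if it is closed in the norm topology. *)

(* Defs.v *)
From HB Require Import structures.
From mathcomp Require Import all_boot all_order all_algebra.
From mathcomp Require Import complex.
From mathcomp Require Import boolp classical_sets functions reals topology.
From mathcomp Require Import normedtype.

Set Implicit Arguments.
Unset Strict Implicit.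
Unset Printing Implicit Defensive.

Import Order.TTheory GRing.Theory Num.Theory.
Import numFieldNormedType.Exports.

Local Open Scope classical_set_scope.
Local Open Scope complex_scope.
Local Open Scope ring_scope.

(* R[i]^o is R[i] with the topology of its modulus.  The compactness proof is
   an argument of the type because the supremum norm below is only a norm on
   bounded functions. *)
Definition Cfun (R : realType) (X : topologicalType)
  (cX : compact [set: X]) : Type := continuousType X (R[i]^o).

Section Cfun.
Context {R : realType} {X : topologicalType} {cX : compact [set: X]}.
Local Notation CX := (Cfun R cX).

HB.instance Definition _ := Choice.copy CX (continuousType X (R[i]^o)).

Definition Cfun_fun (f : CX) : X -> R[i]^o :=
  Continuous.sort (f : continuousType X (R[i]^o)).
Coercion Cfun_fun : Cfun >-> Funclass.

Definition Cfun_mk (f : X -> R[i]^o) (fc : continuous f) : CX :=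
  [the continuousType X (R[i]^o) of mkcts fc].

Lemma Cfun_continuous (f : CX) : continuous (f : X -> R[i]^o).
Proof. exact: (@cts_fun _ _ (f : continuousType X (R[i]^o))). Qed.

Lemma CfunP (f g : CX) : (forall x, f x = g x) -> f = g.
Proof. by move=> fg; apply/continuousEP. Qed.

Lemma Cfun_cst_subproof (a : R[i]) : continuous (fun _ : X => a : R[i]^o).
Proof. by move=> x; exact: cvg_cst. Qed.

Lemma Cfun_opp_subproof (f : CX) : continuous (fun x => - f x).
Proof. by move=> x; apply: cvgN; exact: Cfun_continuous. Qed.

Lemma Cfun_add_subproof (f g : CX) : continuous (fun x => f x + g x).
Proof. by move=> x; apply: cvgD; exact: Cfun_continuous. Qed.

Lemma Cfun_mul_subproof (f g : CX) : continuous (fun x => f x * g x : R[i]^o).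
Proof.
by move=> x; apply: (@cvgZ _ (R[i]^o)); exact: Cfun_continuous.
Qed.

Lemma Cfun_conj_subproof (f : CX) :
  continuous (fun x => (f x : R[i])^* : R[i]^o).
Proof.
move=> x; apply/cvgrPdist_lt => e e0.
have /cvgrPdist_lt/(_ e e0) := @Cfun_continuous f x.
by apply: filterS => y; rewrite -[X in _ -> X < _]normcJ rmorphB /= !conjcK.
Qed.

Definition Cfun_cst (a : R[i]) : CX := Cfun_mk (@Cfun_cst_subproof a).
Definition Cfun_opp (f : CX) : CX := Cfun_mk (@Cfun_opp_subproof f).
Definition Cfun_add (f g : CX) : CX := Cfun_mk (@Cfun_add_subproof f g).
Definition Cfun_mul (f g : CX) : CX := Cfun_mk (@Cfun_mul_subproof f g).
Definition Cfun_scale (a : R[i]) (f : CX) : CX := Cfun_mul (Cfun_cst a) f.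
Definition Cfun_conj (f : CX) : CX := Cfun_mk (@Cfun_conj_subproof f).

Local Lemma Cfun_addA : associative Cfun_add.
Proof. by move=> f g h; apply: CfunP => x; exact: addrA. Qed.
Local Lemma Cfun_addC : commutative Cfun_add.
Proof. by move=> f g; apply: CfunP => x; exact: addrC. Qed.
Local Lemma Cfun_add0 : left_id (Cfun_cst 0) Cfun_add.
Proof. by move=> f; apply: CfunP => x; exact: add0r. Qed.
Local Lemma Cfun_addN : left_inverse (Cfun_cst 0) Cfun_opp Cfun_add.
Proof. by move=> f; apply: CfunP => x; exact: addNr. Qed.

HB.instance Definition _ := GRing.isZmodule.Build CX Cfun_addA Cfun_addC Cfun_add0 Cfun_addN.

Local Lemma Cfun_mulA : associative Cfun_mul.
Proof. by move=> f g h; apply: CfunP => x; exact: mulrA. Qed.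
Local Lemma Cfun_mulC : commutative Cfun_mul.
Proof. by move=> f g; apply: CfunP => x; exact: mulrC. Qed.
Local Lemma Cfun_mul1 : left_id (Cfun_cst 1) Cfun_mul.
Proof. by move=> f; apply: CfunP => x; exact: mul1r. Qed.
Local Lemma Cfun_mulDl : left_distributive Cfun_mul +%R.
Proof. by move=> f g h; apply: CfunP => x; exact: mulrDl. Qed.

(* Possibly-zero ring: C(X) is the zero ring when X is empty. *)
HB.instance Definition _ :=
  GRing.Zmodule_isComPzRing.Build CX Cfun_mulA Cfun_mulC Cfun_mul1 Cfun_mulDl.

Local Lemma Cfun_scaleA a b f : Cfun_scale a (Cfun_scale b f) = Cfun_scale (a * b) f.
Proof. by apply: CfunP => x; exact: mulrA. Qed.
Local Lemma Cfun_scale1 : left_id 1 Cfun_scale.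
Proof. by move=> f; apply: CfunP => x; exact: mul1r. Qed.
Local Lemma Cfun_scaleDr : right_distributive Cfun_scale +%R.
Proof. by move=> a f g; apply: CfunP => x; exact: mulrDr. Qed.
Local Lemma Cfun_scaleDl f : {morph Cfun_scale^~ f : a b / a + b}.
Proof. by move=> a b; apply: CfunP => x; exact: mulrDl. Qed.

HB.instance Definition _ :=
  GRing.Zmodule_isLmodule.Build (R[i]) CX Cfun_scaleA Cfun_scale1 Cfun_scaleDr Cfun_scaleDl.

Definition Cfun_sup (f : CX) : R := sup [set Normc.normc (f x) | x in [set: X]].

(* The library's norms on a module over R[i] take values in R[i]. *)
Definition Cfun_norm (f : CX) : R[i] := (Cfun_sup f)%:C.

Lemma Cfun_normc_continuous (f : CX) :
  continuous (fun x => Normc.normc (f x) : R).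
Proof.
move=> x; apply/cvgrPdist_lt => e e0.
have e0C : (0 : R[i]) < e%:C by rewrite ltcR.
have /cvgrPdist_lt/(_ _ e0C) := @Cfun_continuous f x.
apply: filterS => y; rewrite ltcR; apply: le_lt_trans.
exact: (@ler_dist_dist R (Rcomplex R) (f x) (f y)).
Qed.

Lemma Cfun_bounded (f : CX) :
  has_ubound [set Normc.normc (f x) | x in [set: X]].
Proof.
have cf : {within [set: X], continuous (fun x => Normc.normc (f x) : R)}.
  exact/continuous_subspaceT/Cfun_normc_continuous.
have [M [_ bM]] := compact_bounded (continuous_compact cf cX).
exists (M + 1) => _ [x _ <-]; apply: le_trans (ler_norm _) _.
by apply: (bM (M + 1)); [rewrite ltrDl ltr01|exists x].
Qed.

Lemma Cfun_sup_ub (f : CX) x : Normc.normc (f x) <= Cfun_sup f.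
Proof. by apply: ub_le_sup; [exact: Cfun_bounded|exists x]. Qed.

Lemma normc_ge0 (z : R[i]) : 0 <= Normc.normc z.
Proof. by rewrite -ler0c; exact: (normr_ge0 z). Qed.

Lemma Cfun_sup_empty (f : CX) : ~ ([set: X] !=set0) -> Cfun_sup f = 0.
Proof.
move=> /nonemptyPn X0; rewrite /Cfun_sup.
by rewrite X0 image_set0 sup0.
Qed.

Lemma Cfun_sup_ge0 (f : CX) : 0 <= Cfun_sup f.
Proof.
have [[x _]|X0] := pselect ([set: X] !=set0).
  exact: le_trans (normc_ge0 (f x)) (Cfun_sup_ub f x).
by rewrite Cfun_sup_empty.
Qed.

Lemma Cfun_sup_le (f : CX) (b : R) :
  0 <= b -> (forall x, Normc.normc (f x) <= b) -> Cfun_sup f <= b.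
Proof.
move=> b0 fb; have [[x _]|X0] := pselect ([set: X] !=set0).
  by apply: ge_sup; [exists (Normc.normc (f x)), x|move=> _ [y _ <-]].
by rewrite Cfun_sup_empty.
Qed.

Local Lemma Cfun_norm_triangle f g : Cfun_norm (f + g) <= Cfun_norm f + Cfun_norm g.
Proof.
rewrite -rmorphD /= lecR; apply: Cfun_sup_le => [|x].
  by rewrite addr_ge0 ?Cfun_sup_ge0.
by rewrite (le_trans (le_normcD _ _))// lerD ?Cfun_sup_ub.
Qed.

Local Lemma Cfun_norm_scale (a : R[i]) (f : CX) : Cfun_norm (a *: f) = `|a| * Cfun_norm f.
Proof.
rewrite -[`|a|]/((Normc.normc a)%:C) -rmorphM; congr (_%:C).
have le_scale (b : R[i]) (g : CX) :
    Cfun_sup (b *: g) <= Normc.normc b * Cfun_sup g.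
  apply: Cfun_sup_le => [|x]; first by rewrite mulr_ge0 ?Cfun_sup_ge0 ?normc_ge0.
  change (Normc.normc ((b : R[i]) * g x) <= Normc.normc b * Cfun_sup g).
  rewrite Normc.normcM.
  by rewrite ler_wpM2l ?normc_ge0 ?Cfun_sup_ub.
apply/eqP; rewrite eq_le le_scale /=.
have [->|a0] := eqVneq a 0; first by rewrite Normc.normc0 mul0r Cfun_sup_ge0.
have na0 : 0 < Normc.normc a.
  by rewrite lt_neqAle normc_ge0 andbT eq_sym; apply: contra a0 => /eqP/Normc.eq0_normc->.
rewrite mulrC -ler_pdivlMr // mulrC -Normc.normcV.
by rewrite -{1}[f](scalerK a0); exact: le_scale.
Qed.

Local Lemma Cfun_norm_eq0 f : Cfun_norm f = 0 -> f = 0.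
Proof.
move=> [f0]; apply: CfunP => x; apply: Normc.eq0_normc; apply/eqP.
by rewrite eq_le normc_ge0 andbT -f0 Cfun_sup_ub.
Qed.

HB.instance Definition _ :=
  Lmodule_isNormed.Build (R[i]) CX Cfun_norm_triangle Cfun_norm_scale Cfun_norm_eq0.

Definition is_ideal (I : set CX) : Prop :=
  [/\ I 0,
      forall (a : R[i]) (f g : CX), I f -> I g -> I (a *: f + g),
      forall f : CX, I f -> I (Cfun_conj f)
    & forall f g : CX, I g -> I (f * g)].

Definition closed_ideal (I : set CX) : Prop := is_ideal I /\ closed I.

End Cfun.

(* Main.v *)
Require Import Defs.
From mathcomp Require Import all_boot all_order all_algebra.
From mathcomp Require Import boolp classical_sets functions reals topology.
From mathcomp Require Import complex normedtype.

(** The correspondence sends a closed set [Y] to the ideal of the functions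
    vanishing on [Y]; its inverse sends an ideal to its set of common zeros.

    That [Y] is recovered from its ideal is Urysohn's lemma: a point outside
    [Y] is not a common zero of the functions vanishing on [Y]
    ([zero_locusK]).

    The substantial half is that a closed ideal [I] contains every [f]
    vanishing on its zero locus ([vanishing_idealK]).  For a nonnegative [g]
    in [I] the function [f * (1 + g)^-1 * g] lies in [I] and differs from [f]
    by [f / (1 + g)], so it suffices to find [g] making this quotient
    uniformly small.  At one point this is easy: either [f] is zero there, or
    some [h] in [I] is not, and a large multiple of [|h|^2] serves as [g]
    ([ideal_damp_at]).  Enlarging [g] only decreases the quotient, and the
    nonnegative elements of [I] are directed because sums stay in [I]; the
    passage from points to all of [X] is then compactness, as in Dini's
    theorem ([ideal_damp]). *)

Import Order.TTheory GRing.Theory Num.Theory.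
Import numFieldNormedType.Exports.

Local Open Scope classical_set_scope.
Local Open Scope complex_scope.
Local Open Scope ring_scope.

Section Gelfand_ideals.
Context {R : realType} {X : topologicalType} {cX : compact [set: X]}.
Local Notation CX := (Cfun R cX).
Implicit Types (f g h : CX) (I : set CX) (Y : set X) (x y : X).

(** * Evaluation and the supremum norm *)

Lemma Cfun_addE f g x : Cfun_fun (f + g) x = f x + g x. Proof. by []. Qed.
Lemma Cfun_oppE f x : Cfun_fun (- f) x = - f x. Proof. by []. Qed.
Lemma Cfun_mulE f g x : Cfun_fun (f * g) x = (f x : R[i]) * g x.
Proof. by []. Qed.
Lemma Cfun_scaleE (a : R[i]) f x : Cfun_fun (a *: f) x = a * f x.
Proof. by []. Qed.
Lemma Cfun_conjE f x : Cfun_conj f x = (f x : R[i])^*. Proof. by []. Qed.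

Lemma norm_eval_le f x : `|f x| <= `|f|.
Proof.
rewrite -[`|f x|]/((Normc.normc (f x))%:C) -[`|f|]/((Cfun_sup f)%:C) lecR.
exact: Cfun_sup_ub.
Qed.

(** Norms of [R[i]]-modules take values in [R[i]], where a bound [0 <= e]
    forces [e] to be real; the claim is thus about real suprema. *)
Lemma norm_le_eval f (e : R[i]) :
  0 <= e -> (forall x, `|f x| <= e) -> `|f| <= e.
Proof.
move=> e0 fe; have eE : e = (complex.Re e)%:C by rewrite RRe_real ?ger0_real.
rewrite eE -[`|f|]/((Cfun_sup f)%:C) lecR; apply: Cfun_sup_le => [|x].
  by rewrite -lecR -eE.
by rewrite -lecR -eE; exact: fe.
Qed.

Lemma eval_continuous x : continuous (fun f : CX => f x).
Proof.
move=> f; apply/(@cvgrPdist_lt _ _ _ (nbhs f) (nbhs_filter f)) => e e0.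
apply/nbhs_normP; exists e => //= g fge.
exact: le_lt_trans (norm_eval_le (f - g) x) fge.
Qed.

Lemma real_complex_continuous : continuous (fun r : R => r%:C : R[i]^o).
Proof.
move=> r; apply/cvgrPdist_lt => e e0.
have eE : e = (complex.Re e)%:C by rewrite RRe_real ?gtr0_real.
have r0 : 0 < complex.Re e by rewrite -ltcR -eE.
apply/nbhs_normP; exists (complex.Re e) => //= s rse.
by rewrite -rmorphB normc_def /= expr0n /= addr0 sqrtr_sqr eE ltcR.
Qed.

Lemma closed_zero : closed [set 0 : R[i]^o].
Proof. exact/accessible_closed_set1/hausdorff_accessible/norm_hausdorff. Qed.

(** * Vanishing ideals and zero loci *)

Definition vanishing_ideal Y : set CX := [set f | forall x, Y x -> f x = 0].
Definition zero_locus I : set X := [set x | forall f, I f -> f x = 0].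

Lemma vanishing_ideal_closed_ideal Y : closed_ideal (vanishing_ideal Y).
Proof.
split; first split.
- by [].
- move=> a f g f0 g0 x Yx.
  by rewrite Cfun_addE Cfun_scaleE f0 ?g0 ?mulr0 ?addr0.
- by move=> f f0 x Yx; rewrite Cfun_conjE f0 ?rmorph0.
- by move=> f g g0 x Yx; rewrite Cfun_mulE g0 ?mulr0.
have -> : vanishing_ideal Y =
    \bigcap_(x in Y) (fun f : CX => f x) @^-1` [set 0 : R[i]^o] by [].
apply: closed_bigI => x _; apply: closed_comp => [f _|].
  exact: eval_continuous.
exact: closed_zero.
Qed.

Lemma zero_locus_closed I : closed (zero_locus I).
Proof.
have -> : zero_locus I = \bigcap_(f in I) f @^-1` [set 0 : R[i]^o] by [].
apply: closed_bigI => f _; apply: closed_comp => [x _|].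
  exact: Cfun_continuous.
exact: closed_zero.
Qed.

(** A compact Hausdorff space is normal, so Urysohn's lemma applies to [Y] and
    the closed set [{x}]; its real-valued function is viewed in [R[i]]. *)
Lemma vanishing_separates (hX : hausdorff_space X) Y x :
  closed Y -> ~ Y x -> exists2 f : CX, vanishing_ideal Y f & f x <> 0.
Proof.
move=> cY nYx.
have cx : closed [set x] by exact/accessible_closed_set1/hausdorff_accessible.
have Yx0 : Y `&` [set x] = set0.
  by apply/disjoints_subset => y Yy /= yx; subst y.
have /(@uniform_separatorP _ R)[u [cu _ u0 u1]] :=
  normal_uniform_separator (compact_normal hX cX) cY cx Yx0.
have cf : continuous (fun y => (u y)%:C : R[i]^o).
  move=> y; apply: (@continuous_comp _ _ _ u (fun r : R => r%:C : R[i]^o)).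
    exact: cu.
  exact: real_complex_continuous.
exists (Cfun_mk cf) => [y Yy|]; rewrite -[Cfun_mk cf _]/((u _)%:C).
  by rewrite (u0 (u y)) //; exists y.
by rewrite (u1 (u x)) //; [exact/eqP/oner_neq0|exists x].
Qed.

Lemma zero_locusK (hX : hausdorff_space X) Y :
  closed Y -> zero_locus (vanishing_ideal Y) = Y.
Proof.
move=> cY; apply/seteqP; split=> [x|x Yx f]; last exact.
apply: contraPP => nYx Zx.
by have [f /Zx] := vanishing_separates hX Y x cY nYx.
Qed.

(** * Approximating within an ideal *)

Definition nonneg_in I g := I g /\ forall x, 0 <= g x.

(** The filter of tails of the nonnegative elements of [I] under the pointwise
    order: convergence along it is convergence of a net indexed by them. *)
Definition eventually_in I : set_system CX :=
  [set A | exists2 g, nonneg_in I g &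
    forall h, nonneg_in I h -> (forall x, g x <= h x) -> A h].

Lemma ideal_add I f g : is_ideal I -> I f -> I g -> I (f + g).
Proof. by case=> _ lI _ _ If Ig; rewrite -[f]scale1r; exact: lI. Qed.

Lemma eventually_in_filter I : is_ideal I -> Filter (eventually_in I).
Proof.
move=> idI; split.
- by exists 0 => //; split=> //; case: idI.
- move=> A B [g [Ig g0] gA] [h [Ih h0] hB].
  exists (g + h) => [|k Ik ghk].
    by split=> [|x]; [exact: ideal_add|rewrite Cfun_addE addr_ge0].
  split; [apply: gA => // x|apply: hB => // x]; apply: le_trans (ghk x).
    by rewrite Cfun_addE lerDl.
  by rewrite Cfun_addE lerDr.
- by move=> A B AB [g Ig gA]; exists g => // h Ih gh; exact/AB/gA.
Qed.

Lemma inv1D_continuous g :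
  (forall x, 0 <= g x) -> continuous (fun x => (1 + g x)^-1 : R[i]^o).
Proof.
move=> g0 x; apply: (@cvgV R[i]); first by rewrite gt_eqF // ltr_pwDl.
by apply: cvgD; [exact: cvg_cst|exact: Cfun_continuous].
Qed.

(** Where [h] in [I] is nonzero, [g] is [|h|^2 = h^* h] scaled so that
    [e * g x = |f x|]; then [e * (1 + g x)] exceeds [|f x|]. *)
Lemma ideal_damp_at I f x (e : R[i]) : is_ideal I ->
  (zero_locus I x -> f x = 0) -> 0 < e ->
  exists2 g, nonneg_in I g & `|f x| / (1 + g x) < e.
Proof.
move=> idI fx0 e0; have [I0 linI conjI mulI] := idI.
have [Zx|/existsNP[h /not_implyP[Ih /eqP hx0]]] := pselect (zero_locus I x).
  by exists 0 => //; rewrite fx0 // normr0 mul0r.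
pose t := `|f x| / (e * `|h x| ^+ 2).
have t0 : 0 <= t by rewrite divr_ge0 // mulr_ge0 ?exprn_ge0 // ltW.
pose g : CX := t *: (Cfun_conj h * h).
have gE y : g y = t * `|h y| ^+ 2.
  rewrite /g Cfun_scaleE Cfun_mulE Cfun_conjE sqr_normc.
  by congr (_ * _); exact: mulrC.
have g0 y : 0 <= g y by rewrite gE mulr_ge0 // exprn_ge0.
exists g.
  by split=> //; rewrite -[g]addr0; apply: linI => //; exact: mulI.
rewrite ltr_pdivrMr ?ltr_pwDl // gE /t.
have hn0 : `|h x| ^+ 2 != 0 by rewrite expf_neq0 // normr_eq0.
rewrite mulrDr mulr1 invfM -!mulrA mulVf // mulr1 mulrCA.
by rewrite divff ?gt_eqF // mulr1 ltrDr.
Qed.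

(** Compactness turns the pointwise bound into a uniform one: a bound at [x]
    for [g0] persists on a neighbourhood of [x] by continuity and for every
    [g] above [g0] by monotonicity, which is what the near-covering form of
    compactness asks for along [eventually_in I]. *)
Lemma ideal_damp I f (e : R[i]) : is_ideal I ->
  vanishing_ideal (zero_locus I) f -> 0 < e ->
  exists2 g, nonneg_in I g & forall x, `|f x| / (1 + g x) < e.
Proof.
move=> idI fZ e0; have FI := eventually_in_filter I idI.
have /compact_near_coveringP nX := cX.
pose small g x : Prop := `|f x| / (1 + g x) < e.
have [|g Ig gP] := nX _ _ small FI; last first.
  by exists g => // x; exact: gP.
move=> x _; have [g0 Ig0 fg0] := ideal_damp_at I f x e idI (fZ x) e0.
have cfg : continuous (fun y => f y * (1 + g0 y)^-1 : R[i]^o).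
  move=> y; apply: (@cvgM R[i]); first exact: Cfun_continuous.
  exact: (inv1D_continuous g0 Ig0.2).
have g0_gt0 y : 0 < 1 + g0 y by rewrite ltr_pwDl // Ig0.2.
have normE y : `|f y * (1 + g0 y)^-1| = `|f y| / (1 + g0 y).
  by rewrite normrM normfV (gtr0_norm (g0_gt0 y)).
have nx : \forall y \near x, `|f y| / (1 + g0 y) < e.
  have := @cvgr_norm_lt _ _ _ _ _ _ _ (cfg x) e.
  rewrite normE => /(_ _ fg0); by apply: filterS => y; rewrite normE.
exists ([set y | `|f y| / (1 + g0 y) < e],
        [set g | nonneg_in I g /\ forall y, g0 y <= g y]).
  by split=> //=; exists g0.
move=> [y g] /= [yU [Ig g0g]]; apply: le_lt_trans yU.
rewrite ler_wpM2l // lef_pV2 ?posrE ?lerD2l //.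
by rewrite (lt_le_trans (g0_gt0 y)) // lerD2l.
Qed.

(** As [I] is closed, it is enough to find elements of [I] arbitrarily close to
    [f]; these are [f * (1 + g)^-1 * g] with [g] from [ideal_damp]. *)
Lemma vanishing_idealK I : closed_ideal I -> vanishing_ideal (zero_locus I) = I.
Proof.
move=> [idI clI]; apply/seteqP; split=> [f fZ|f If x]; last exact.
apply: clI => B /nbhs_normP[e /= e0 eB].
(* Pointwise strict bounds only bound the norm weakly, hence [e / 2]. *)
have e20 : 0 < e / 2 by rewrite divr_gt0.
have [g [Ig g0] fg] := ideal_damp I f _ idI fZ e20.
pose k : CX := Cfun_mk (inv1D_continuous g g0).
have kE x : k x = (1 + g x)^-1 by [].
exists (f * k * g); split; first by case: idI => _ _ _; exact.
apply: eB => /=; apply: le_lt_trans (_ : e / 2 < e); last first.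
  by rewrite ltr_pdivrMr // mulr_natr mulr2n ltrDl.
apply: norm_le_eval => [|x]; first exact: ltW.
have gx0 : 0 < 1 + g x by rewrite ltr_pwDl.
have -> : Cfun_fun (f - f * k * g) x = f x / (1 + g x).
  rewrite Cfun_addE Cfun_oppE !Cfun_mulE kE.
  apply: (mulIf (lt0r_neq0 gx0)); rewrite mulrBl divfK ?lt0r_neq0 //.
  by rewrite mulrAC divfK ?lt0r_neq0 // mulrDr mulr1 addrK.
by rewrite normrM normfV (gtr0_norm gx0) ltW.
Qed.

End Gelfand_ideals.

Theorem theorem6p2 (R : realType) (X : topologicalType)
    (cX : compact [set: X]) (hX : hausdorff_space X) :
  exists Phi : set X -> set (Cfun R cX),
    set_bij [set Y | closed Y] [set I | closed_ideal I] Phi.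
Proof.
exists vanishing_ideal; split.
- by move=> Y _; exact: vanishing_ideal_closed_ideal.
- move=> Y1 Y2 /set_mem cY1 /set_mem cY2 eqY.
  by rewrite -(@zero_locusK R X cX hX Y1 cY1) eqY zero_locusK.
- move=> I cI; exists (zero_locus I); first exact: zero_locus_closed.
  exact: vanishing_idealK.
Qed.
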